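(* Let $t$ be arbitrary, and for $n\ge 0$ let $f_n$ denote the total weight of the lattice paths from $(0,0)$ to $(2n,0)$ that never run beneath the $x$-axis and use the steps $U=(1,1)$, $H=(2,0)$, $D=(1,-1)$, where each $H$ step has weight $t$ and each $U$ and $D$ step has weight $1$. Equivalently, let $(f_n)_{n\ge0}$ be determined by $$F(x)=\sum_{n\ge0}f_nx^n=1+txF(x)+xF(x)^2.$$ Then for every $n\ge1$ the determinant of the $n$-th order Hankel matrix $(f_{i+j-2})_{1\le i,j\le n}$ equals $(1+t)^{n(n-1)/2}$.
   Context: The weight of a path is the product of the weights of its steps; the weight of a set of paths is the sum of the weights of its paths. The path of length zero has weight $1$. The weight $t$ may be taken to be an arbitrary number or an indeterminate. *)

(* Defs.v *)
From HB Require Import structures.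
From mathcomp Require Import all_boot all_order all_algebra.

Set Implicit Arguments.
Unset Strict Implicit.
Unset Printing Implicit Defensive.

Import Order.TTheory GRing.Theory Num.Theory.
Local Open Scope ring_scope.

(** * Lattice paths *)

Inductive step := stepU | stepH | stepD.

Definition code_of_step (s : step) : option bool :=
  match s with stepU => Some true | stepH => None | stepD => Some false end.

Definition step_of_code (c : option bool) : step :=
  match c with Some true => stepU | None => stepH | Some false => stepD end.

Lemma code_of_stepK : cancel code_of_step step_of_code.
Proof. by case. Qed.

HB.instance Definition _ := Finite.copy step (can_type code_of_stepK).

Definition step_vec (s : step) : int * int :=
  match s with
  | stepU => (1, 1)
  | stepH => (2, 0)
  | stepD => (1, -1)
  end.

Definition vertices (p : seq step) : seq (int * int) :=
  (0, 0) :: scanl (fun v s => v + step_vec s) (0, 0) p.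

Definition never_beneath (p : seq step) : bool :=
  all (fun v : int * int => 0 <= v.2) (vertices p).

Definition schroeder_path (n : nat) (p : seq step) : bool :=
  (last (0, 0) (vertices p) == ((2 * n)%N%:Z, 0)) && never_beneath p.

(* Every step moves at least one unit to the right. *)
Lemma size_schroeder_path (n : nat) (p : seq step) :
  schroeder_path n p -> (size p <= 2 * n)%N.
Proof.
case/andP=> /eqP e _.
have H (q : seq step) (v : int * int) :
    v.1 + (size q)%:Z
      <= (last v (scanl (fun v s => v + step_vec s) v q)).1.
  elim: q v => [|s q IH] v /=; first by rewrite addr0.
  apply: le_trans (IH (v + step_vec s)).
  rewrite -addn1 PoszD [X in _ + X]addrC addrA lerD2r lerD2l.
  by case: s.
by have := H p (0, 0); rewrite /vertices /= in e *; rewrite e add0r.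
Qed.

Section Weights.
Variables (R : comNzRingType) (t : R).

Definition step_weight (s : step) : R :=
  match s with stepU => 1 | stepH => t | stepD => 1 end.

Definition path_weight (p : seq step) : R := \prod_(s <- p) step_weight s.

(* A path from (0, 0) to (2n, 0) has at most 2n steps (size_schroeder_path),
   so the sum over lengths k <= 2n runs over all such paths. *)
Definition schroeder_weight (n : nat) : R :=
  \sum_(k < (2 * n)%N.+1)
    \sum_(p : k.-tuple step | schroeder_path n p) path_weight p.

End Weights.

(** * Formal power series, represented by their coefficient sequences *)

Section PowerSeries.
Variable R : comNzRingType.
Implicit Types (F G : nat -> R) (c : R).

Definition fps_const c : nat -> R := fun n => if n == 0%N then c else 0.

Definition fps_X : nat -> R := fun n => (n == 1%N)%:R.

Definition fps_add F G : nat -> R := fun n => F n + G n.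

Definition fps_mul F G : nat -> R := fun n => \sum_(i < n.+1) F i * G (n - i)%N.

Definition schroeder_equation (t : R) F : Prop :=
  F =1 fps_add (fps_add (fps_const 1)
                        (fps_mul (fps_mul (fps_const t) fps_X) F))
               (fps_mul fps_X (fps_mul F F)).

Definition hankel (n : nat) F : 'M[R]_n := \matrix_(i < n, j < n) F (i + j)%N.

End PowerSeries.

(* Main.v *)
Require Import Defs.
From mathcomp Require Import all_boot all_order all_algebra.
From mathcomp Require Import zify ring.

Import GRing.Theory.
Local Open Scope ring_scope.

(** Let [W n h] be the total weight of the paths that start at height [h], never
    run beneath the axis, and reach it after a horizontal distance [2 n + h].
    Splitting off the first step gives
      [W (n+1) (h+1) = W (n+1) h + W n (h+2) + t * W n (h+1)],
    with boundary values [W 0 h = 1] and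
      [W (n+1) 0 = W n 1 + t * W n 0];
    everything else is derived from this linear recurrence.

    The functional equation.  A path from height [h+1] reaches height [h] for a
    first time, so the sequence [W _ (h+1)] is the convolution of [W _ 0] with
    [W _ h] (weight_from_first_passage).  Taking [h = 0] and substituting in the
    formula for [W (n+1) 0] gives [F = 1 + t x F + x F^2] for the path weights.
    The equation expresses each coefficient by the earlier ones, so it has no
    other solution.

    The determinant.  Put [c = 1 + t].  The continued fraction of J-type of [F]
    has linear coefficients [c, 1 + c, 1 + c, ...] and all its quadratic
    coefficients are [c]; let [L] be the lower unitriangular matrix produced by
    the corresponding three-term recurrence (tridiag).  That the column 0 of [L]
    is [F] follows from the change of basis
      [W n h = \sum_k 'C(h, k) * c ^ k * L n k]
    (weight_from_tridiag), since both sides satisfy the same recurrence.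
    On the other hand the tridiagonal operator is self-adjoint for the weights
    [c ^ k], so that
      [\sum_k L i k * c ^ k * L j k]
    depends on [i + j] alone (weighted_dotE, through a Christoffel-Darboux
    identity) and equals [L (i + j) 0].  Hence the Hankel matrix factors as
    [L * D * L^T] with [D] the diagonal matrix of the [c ^ k], and its
    determinant is [c ^ (0 + 1 + ... + (n-1))].  No division by [c] occurs, so
    the argument is valid over every commutative ring. *)

(** * Paths from an arbitrary height *)

(** The total weight of the paths from height [h] that end on the axis after a
    horizontal distance [2 n + h]: index [j] is the height at which the initial
    run of [D] steps stops, and the two terms are the next step [U] or [H].
    Counting [n] instead of the horizontal distance removes the parity
    condition and makes [n] drop by one at each [U] and each [H]. *)
Fixpoint weight_from {R : comNzRingType} (t : R) (n h : nat) : R :=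
  if n is n'.+1 then
    \sum_(j < h.+1) (weight_from t n' j.+1 + t * weight_from t n' j)
  else 1.

Lemma weight_fromS0 (R : comNzRingType) (t : R) n :
  weight_from t n.+1 0 = weight_from t n 1 + t * weight_from t n 0.
Proof. by rewrite /= big_ord_recr big_ord0 /= add0r. Qed.

Lemma weight_fromSS (R : comNzRingType) (t : R) n h :
  weight_from t n.+1 h.+1 =
  weight_from t n.+1 h + (weight_from t n h.+2 + t * weight_from t n h.+1).
Proof. by rewrite /= big_ord_recr. Qed.

(** Never running beneath the axis and ending on it at distance [2 n + h], as a
    recursion on the first step, starting at height [h]. *)
Fixpoint descends (p : seq step) (n h : nat) : bool :=
  match p with
  | [::] => (n == 0%N) && (h == 0%N)
  | stepU :: q => if n is n'.+1 then descends q n' h.+1 else false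
  | stepH :: q => if n is n'.+1 then descends q n' h else false
  | stepD :: q => if h is h'.+1 then descends q n h' else false
  end.

(** No step decreases the sum of the coordinates, so a point of height [h] is
    too high to come down within a horizontal distance less than [h]. *)
Lemma scanl_step_slope (p : seq step) (v : int * int) :
  let w := last v (scanl (fun u s => u + step_vec s) v p) in
  v.1 + v.2 <= w.1 + w.2.
Proof.
elim: p v => [|s p IH] v //=.
apply: Order.POrderTheory.le_trans (IH _).
by case: v => a b; case: s => /=; lia.
Qed.

Lemma descendsE (p : seq step) (a : int) (n h : nat) :
  let vs := scanl (fun v s => v + step_vec s) (a, h%:Z) p in
  (last (a, h%:Z) vs == (a + (2 * n + h)%N%:Z, 0))
    && all (fun v : int * int => 0 <= v.2) vs = descends p n h.
Proof.
elim: p a n h => [|s p IH] a n h /=.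
  by rewrite andbT xpair_eqE; lia.
case: s => /=.
- have -> : ((a, h%:Z) : int * int) + (1, 1) = (a + 1, h.+1%:Z).
    by congr (_, _); rewrite /=; lia.
  case: n => [|n].
    apply/negP => /andP[/eqP E _].
    by have := scanl_step_slope p (a + 1, h.+1%:Z); rewrite E /=; lia.
  rewrite -(IH (a + 1)) /=.
  by have -> : a + (2 * n.+1 + h)%N = a + 1 + (2 * n + h.+1)%N by lia.
- have -> : ((a, h%:Z) : int * int) + (2, 0) = (a + 2, h%:Z).
    by congr (_, _); rewrite /=; lia.
  case: n => [|n].
    apply/negP => /andP[/eqP E _].
    by have := scanl_step_slope p (a + 2, h%:Z); rewrite E /=; lia.
  rewrite -(IH (a + 2)) /=.
  by have -> : a + (2 * n.+1 + h)%N = a + 2 + (2 * n + h)%N by lia.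
case: h => [|h]; first by rewrite andbF.
have -> : ((a, h.+1%:Z) : int * int) + (1, -1) = (a + 1, h%:Z).
  by congr (_, _); rewrite /=; lia.
have -> /= : 0 <= h.+1%:Z - 1 by lia.
rewrite -(IH (a + 1)) /=.
by have -> : a + (2 * n + h.+1)%N = a + 1 + (2 * n + h)%N by lia.
Qed.

Lemma schroeder_pathE n p : schroeder_path n p = descends p n 0.
Proof.
by rewrite -(descendsE p 0) /schroeder_path /never_beneath /= add0r addn0.
Qed.

Lemma big_tuple_cons (V : nmodType) (T : finType) k
    (P : pred (seq T)) (F : seq T -> V) :
  \sum_(p : k.+1.-tuple T | P p) F p =
  \sum_s \sum_(q : k.-tuple T | P (s :: q)) F (s :: q).
Proof.
rewrite pair_big_dep /=.
rewrite (reindex (fun u : T * k.-tuple T => [tuple of u.1 :: u.2])) //=.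
exists (fun p : k.+1.-tuple T => (thead p, [tuple of behead p])).
- by case=> s q _; congr (_, _); apply: val_inj.
- by move=> p _; rewrite [RHS](tuple_eta p); apply: val_inj.
Qed.

Lemma big_step (V : nmodType) (F : step -> V) :
  \sum_s F s = F stepU + F stepH + F stepD.
Proof.
rewrite -big_enum (perm_big [:: stepU; stepH; stepD]) /=.
  by rewrite !big_cons big_nil addr0 addrA.
by apply: uniq_perm => // [|s]; rewrite ?enum_uniq // mem_enum; case: s.
Qed.

(** Induction on the bound for the length, by removal of the first step. *)
Lemma sum_descends (R : comNzRingType) (t : R) N n h :
  (2 * n + h < N)%N ->
  \sum_(k < N) \sum_(p : k.-tuple step | descends p n h) path_weight t p =
  weight_from t n h.
Proof.
elim: N n h => [|N IH] n h // lt_N.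
pose A s :=
  \sum_(k < N) \sum_(q : k.-tuple step | descends (s :: q) n h) path_weight t q.
have -> : \sum_(k < N.+1) \sum_(p : k.-tuple step | descends p n h)
              path_weight t p =
          ((n == 0%N) && (h == 0%N))%:R + (A stepU + t * A stepH + A stepD).
  rewrite big_ord_recl; congr (_ + _).
    rewrite (eq_bigl (fun=> (n == 0%N) && (h == 0%N))) => [|p]; last first.
      by rewrite tuple0.
    case: (_ && _); last by rewrite big_pred0_eq.
    rewrite (big_pred1 [tuple]) => [|p]; last by rewrite [p]tuple0; apply/esym/eqP.
    by rewrite /path_weight big_nil.
  rewrite /A mulr_sumr -!big_split /=; apply: eq_bigr => k _.
  rewrite (big_tuple_cons _ _ _ (fun p => descends p n h)) big_step mulr_sumr.
  by congr (_ + _ + _); apply: eq_bigr => q _;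
    rewrite /path_weight big_cons /= ?mul1r.
rewrite /A {A}.
have no_path : \sum_(k < N) \sum_(q : k.-tuple step | false) path_weight t q = 0.
  by rewrite big1 // => k _; rewrite big_pred0_eq.
case: n lt_N => [|n] lt_N; case: h lt_N => [|h] lt_N /=.
- by rewrite no_path mulr0 !addr0.
- by rewrite no_path mulr0 !add0r IH //; lia.
- by rewrite no_path !IH ?add0r ?addr0 -?weight_fromS0 //; lia.
- by rewrite add0r [LHS]addrC !IH -?weight_fromSS //; lia.
Qed.

Lemma schroeder_weightE (R : comNzRingType) (t : R) n :
  schroeder_weight t n = weight_from t n 0.
Proof.
rewrite -(sum_descends R t (2 * n)%N.+1) ?addn0 //.
by apply: eq_bigr => k _; apply: eq_bigl => p; rewrite schroeder_pathE.
Qed.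

(** * The functional equation *)

Lemma fps_mulSr (R : comNzRingType) (F G : nat -> R) n :
  fps_mul F G n.+1 = F n.+1 * G 0%N + fps_mul F (fun m => G m.+1) n.
Proof.
rewrite /fps_mul big_ord_recr /= subnn addrC; congr (_ + _).
by apply: eq_bigr => i _; rewrite subSn // -ltnS.
Qed.

Lemma fps_mulDr (R : comNzRingType) (F G H : nat -> R) n :
  fps_mul F (fun m => G m + H m) n = fps_mul F G n + fps_mul F H n.
Proof. by rewrite -big_split; apply: eq_bigr => i _; rewrite mulrDr. Qed.

Lemma fps_mulZr (R : comNzRingType) c (F G : nat -> R) n :
  fps_mul F (fun m => c * G m) n = c * fps_mul F G n.
Proof. by rewrite mulr_sumr; apply: eq_bigr => i _; rewrite mulrCA. Qed.

Lemma eq_fps_mul (R : comNzRingType) (F F' G G' : nat -> R) :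
  F =1 F' -> G =1 G' -> fps_mul F G =1 fps_mul F' G'.
Proof. by move=> eF eG n; apply: eq_bigr => i _; rewrite eF eG. Qed.

(** Cutting a path from height [h+1] at its first visit to height [h] gives this
    convolution.  The induction avoids the cut itself: convolution with a fixed
    sequence is linear, so the right-hand side inherits the recurrence of
    [weight_from]. *)
Lemma weight_from_first_passage (R : comNzRingType) (t : R) n h :
  weight_from t n h.+1 =
  fps_mul (weight_from t ^~ 0%N) (weight_from t ^~ h) n.
Proof.
elim: n h => [|n IHn] h; first by rewrite /fps_mul big_ord1 /= mulr1.
elim: h => [|h IHh]; rewrite weight_fromSS fps_mulSr mulr1.
  rewrite (eq_fps_mul _ _ _ _ _ (frefl _) (weight_fromS0 _ t)).
  by rewrite fps_mulDr fps_mulZr -!IHn.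
rewrite (eq_fps_mul _ _ _ _ _ (frefl _) (fun m => weight_fromSS _ t m h)).
rewrite fps_mulDr fps_mulDr fps_mulZr -!IHn [RHS]addrA; congr (_ + _).
by rewrite IHh fps_mulSr mulr1.
Qed.

(** The coefficientwise form of the equation, from which both existence and
    uniqueness of the solution are read off. *)
Lemma schroeder_equationP (R : comNzRingType) (t : R) (F : nat -> R) :
  schroeder_equation t F <->
  F 0%N = 1 /\ forall n, F n.+1 = t * F n + fps_mul F F n.
Proof.
have mulXS G n : fps_mul (fps_X R) G n.+1 = G n.
  rewrite /fps_mul big_ord_recl mul0r add0r big_ord_recl mul1r subSS subn0.
  by rewrite big1 ?addr0 // => i _; rewrite mul0r.
have mulX0 G : fps_mul (fps_X R) G 0%N = 0.
  by rewrite /fps_mul big_ord1 mul0r.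
have mulC c G : fps_mul (fps_const c) G =1 (fun n => c * G n).
  move=> n; rewrite /fps_mul big_ord_recl subn0 big1 ?addr0 // => i _.
  by rewrite mul0r.
have mulCXS n : fps_mul (fps_mul (fps_const t) (fps_X R)) F n.+1 = t * F n.
  rewrite -(mulXS F) mulr_sumr; apply: eq_bigr => i _.
  by rewrite mulC mulrA.
have mulCX0 : fps_mul (fps_mul (fps_const t) (fps_X R)) F 0%N = 0.
  by rewrite [LHS]big_ord1 mulC mulr0 mul0r.
split=> [eqF|[F0 FS] [|n]].
- split=> [|n]; rewrite eqF /fps_add /fps_const.
    by rewrite mulCX0 mulX0 !addr0.
  by rewrite mulCXS mulXS add0r.
- by rewrite /fps_add /fps_const mulCX0 mulX0 !addr0.
- by rewrite /fps_add /fps_const mulCXS mulXS add0r.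
Qed.

Lemma schroeder_equation_weight_from (R : comNzRingType) (t : R) :
  schroeder_equation t (weight_from t ^~ 0%N).
Proof.
apply/schroeder_equationP; split=> // n.
by rewrite weight_fromS0 weight_from_first_passage addrC.
Qed.

Lemma schroeder_equation_uniq (R : comNzRingType) (t : R) (F G : nat -> R) :
  schroeder_equation t F -> schroeder_equation t G -> F =1 G.
Proof.
move=> /schroeder_equationP[F0 FS] /schroeder_equationP[G0 GS] n.
elim/ltn_ind: n => -[|n] IH; first by rewrite F0 G0.
rewrite FS GS IH //; congr (_ + _); apply: eq_bigr => i _.
by rewrite !IH // ltnS ?leq_subr // -ltnS.
Qed.

Lemma eq_schroeder_equation (R : comNzRingType) (t : R) (F G : nat -> R) :
  F =1 G -> schroeder_equation t G -> schroeder_equation t F.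
Proof.
move=> eFG /schroeder_equationP[G0 GS].
apply/schroeder_equationP; split=> [|n]; first by rewrite eFG.
by rewrite !eFG GS (eq_fps_mul _ _ _ _ _ eFG eFG).
Qed.

(** * The tridiagonal recurrence *)

(** The total weight of the Motzkin paths of length [n] that start at height 0
    and end at height [k], where an up step has weight [1], a down step [1 + t],
    a level step [1 + t] at height 0 and [2 + t] above. *)
Fixpoint tridiag {R : comNzRingType} (t : R) (n k : nat) : R :=
  if n is n'.+1 then
    if k is k'.+1 then
      tridiag t n' k' + (2 + t) * tridiag t n' k + (1 + t) * tridiag t n' k.+1
    else (1 + t) * tridiag t n' 0 + (1 + t) * tridiag t n' 1
  else (k == 0%N)%:R.

Lemma tridiag_gt (R : comNzRingType) (t : R) n k : (n < k)%N -> tridiag t n k = 0.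
Proof.
elim: n k => [|n IH] [|k] //= lt_nk.
by rewrite !IH ?mulr0 ?addr0 //; lia.
Qed.

Lemma tridiag_diag (R : comNzRingType) (t : R) n : tridiag t n n = 1.
Proof.
elim: n => [|n IH] //=.
by rewrite IH !tridiag_gt ?mulr0 ?addr0.
Qed.

Definition binomial_transform {R : nzRingType} (f : nat -> R) (h : nat) : R :=
  \sum_(k < h.+1) f k *+ 'C(h, k).

Lemma binomial_transformS (R : nzRingType) (f : nat -> R) h :
  binomial_transform f h.+1 =
  binomial_transform f h + binomial_transform (fun k => f k.+1) h.
Proof.
rewrite /binomial_transform big_ord_recl /= [X in _ = X + _]big_ord_recl /=.
rewrite -addrA; congr (_ + _); rewrite ?bin0 //.
under eq_bigr => i _ do rewrite /bump /= add1n binS mulrnDr.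
rewrite big_split /=; congr (_ + _).
by rewrite big_ord_recr /= bin_small ?mulr0n ?addr0.
Qed.

(** In terms of generating functions, the columns of [weight_from] are the
    powers [F ^ (h+1)] and those of [tridiag] are [F * (x G) ^ k], where
    [F = 1 + (1 + t) x G]; the identity expands [F * (1 + (1 + t) x G) ^ h] by
    the binomial theorem.  It is proved by checking that the right-hand side
    satisfies the recurrence of [weight_from], with Pascal's rule in the role
    of the binomial theorem. *)
Lemma weight_from_tridiag (R : comNzRingType) (t : R) n h :
  weight_from t n h =
  binomial_transform (fun k => (1 + t) ^+ k * tridiag t n k) h.
Proof.
elim: n h => [|n IHn] h.
  rewrite /binomial_transform big_ord_recl /= mulr1 bin0 big1 ?addr0 // => i _.
  by rewrite mulr0 mul0rn.
elim: h => [|h IHh].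
  rewrite weight_fromS0 !IHn binomial_transformS /binomial_transform.
  by rewrite !big_ord1 /= !bin0 !mulr1n; ring.
rewrite weight_fromSS IHh !IHn [RHS]binomial_transformS; congr (_ + _).
rewrite !binomial_transformS.
(* By Pascal's rule everything becomes a combination of the binomial
   transforms of [f] and its first two shifts, at the same index. *)
set f := fun k => _.
pose B g := @binomial_transform R g h.
transitivity ((1 + t) * B f + (2 + t) * B (fun k => f k.+1) + B (fun k => f k.+2)).
  by rewrite /B; ring.
rewrite /B /binomial_transform !mulr_sumr -!big_split /=; apply: eq_bigr => k _.
by rewrite !mulrnAr -!mulrnDl; congr (_ *+ _); rewrite /f /= !exprS; ring.
Qed.

Lemma tridiag0 (R : comNzRingType) (t : R) n :
  tridiag t n 0 = schroeder_weight t n.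
Proof.
rewrite schroeder_weightE weight_from_tridiag /binomial_transform big_ord1.
by rewrite mul1r bin0.
Qed.

(** * The Hankel determinant *)

Definition weighted_dot {R : comNzRingType} (t : R) (K i j : nat) : R :=
  \sum_(k < K) tridiag t i k * (1 + t) ^+ k * tridiag t j k.

(** Moving one application of the tridiagonal operator from one factor to the
    other telescopes, as the operator is self-adjoint for the weights
    [(1 + t) ^ k]; only a boundary term at the truncation point is left. *)
Lemma weighted_dot_christoffel_darboux (R : comNzRingType) (t : R) K i j :
  weighted_dot t K.+1 i.+1 j - weighted_dot t K.+1 i j.+1 =
  (1 + t) ^+ K.+1 *
    (tridiag t i K.+1 * tridiag t j K - tridiag t i K * tridiag t j K.+1).
Proof.
elim: K => [|K IH].
  by rewrite /weighted_dot !big_ord1 /=; ring.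
rewrite /weighted_dot big_ord_recr [X in _ - X]big_ord_recr opprD addrACA.
rewrite [X in X + _]IH /= !exprS; ring.
Qed.

(** When the truncation lies beyond both rows, the boundary term vanishes; all
    of [i] can then be moved to [j], and row 0 picks out column 0. *)
Lemma weighted_dotE (R : comNzRingType) (t : R) K i j :
  (i + j < K)%N -> weighted_dot t K i j = tridiag t (i + j) 0.
Proof.
case: K => // K; elim: i j => [|i IH] j lt_K.
  rewrite /weighted_dot big_ord_recl !mul1r big1 ?addr0 // => k _.
  by rewrite !mul0r.
rewrite addSnnS -IH; last by lia.
apply/eqP; rewrite -subr_eq0 weighted_dot_christoffel_darboux.
by rewrite !tridiag_gt ?(mulr0, mul0r, subr0) //; lia.
Qed.

Lemma weighted_dot_widen (R : comNzRingType) (t : R) K m i j :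
  (i < K)%N -> weighted_dot t (K + m) i j = weighted_dot t K i j.
Proof.
move=> lt_iK; rewrite /weighted_dot big_split_ord /= [X in _ + X]big1 ?addr0 //.
by move=> k _; rewrite tridiag_gt ?mul0r //; lia.
Qed.

Lemma hankel_LDL (R : comNzRingType) (t : R) n :
  let L : 'M_n := \matrix_(i, k) tridiag t i k in
  let D : 'rV_n := \row_k (1 + t) ^+ k in
  hankel n (schroeder_weight t) = L *m diag_mx D *m L^T.
Proof.
move=> L D; apply/matrixP => i j; rewrite !mxE -tridiag0.
(* The identity for row products needs a long range of summation; the extra
   terms vanish by triangularity. *)
rewrite -(weighted_dotE R t (n + (i + j).+1)%N) ?weighted_dot_widen //; last by lia.
by apply: eq_bigr => k _; rewrite mul_mx_diag !mxE.
Qed.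

Theorem proposition2p1 (R : comNzRingType) (t : R) :
  (forall F : nat -> R,
     schroeder_equation t F <-> F =1 schroeder_weight t) /\
  (forall n : nat, (1 <= n)%N ->
     \det (hankel n (schroeder_weight t)) = (1 + t) ^+ ((n * (n - 1)) %/ 2)%N).
Proof.
have sol : schroeder_equation t (schroeder_weight t).
  apply: eq_schroeder_equation (schroeder_equation_weight_from R t).
  exact: schroeder_weightE.
split=> [F|n _].
  split=> [eqF|eF]; first exact: schroeder_equation_uniq eqF sol.
  exact: eq_schroeder_equation eF sol.
rewrite hankel_LDL !det_mulmx det_tr det_diag det_trig; last first.
  by apply/is_trig_mxP => i j lt_ij; rewrite mxE tridiag_gt.
rewrite big1 => [|i _]; last by rewrite mxE tridiag_diag.
rewrite mul1r mulr1; under eq_bigr => i _ do rewrite mxE.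
by rewrite prodrXr divn2 subn1 -bin2 -bin2_sum big_mkord.
Qed.
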